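(* For every $n\in\{2,6,10,\dots\}$, the greedy local search procedure applied to $g_n$ starting from the zero vector has no ties at any step (so its path is uniquely determined), it terminates at the unique local maximum of $g_n$, namely the complement of the characteristic vector of the set $\{4,8,\dots,n-2\}$ (i.e. the vector with $x_i=0$ for $i\in\{4,8,\dots,n-2\}$ and $x_i=1$ otherwise), and the path has length greater than $2^{n/4}$. In particular greedy local search takes exponentially many steps, both in $n$ and in the size of $g_n$.
   Context: For $n\in\{2,6,10,\dots\}$ define polynomials $g_n$ in variables $x_1,\dots,x_n$ (evaluated on $\{0,1\}^n$) recursively: $g_2(x_1,x_2):=2x_1+x_2$, and, with $\mathbf{x}=(x_1,\dots,x_n)$ and $M_n:=4\big(\max_{\{0,1\}^n} g_n-\min_{\{0,1\}^n} g_n\big)$, $g_{n+4}(\mathbf{x},x_{n+1},x_{n+2},x_{n+3},x_{n+4}) := 4g_n(\mathbf{x}) + 3x_{n+1} - \sum_{i=1}^n (2M_n+i+2)x_i x_{n+2} + 3M_n n\, x_{n+1}x_{n+2} + 2x_{n+3} + M_n x_{n+1}x_{n+3} - 4M_n n\, x_{n+2}x_{n+4} + 5M_n n\, x_{n+3}x_{n+4}$. Greedy local search on $f:\{0,1\}^m\to\mathbb{R}$: starting from a vertex, at each step, if some neighbor (vertex differing in exactly one coordinate) has strictly larger value, move to a neighbor with the largest value among all neighbors; otherwise stop (the current vertex is a local maximum). A tie occurs if two distinct neighbors attain this largest value. The length of the path is the number of moves. *)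

(* Defs.v *)
From mathcomp Require Import all_boot all_order all_algebra.
Set Implicit Arguments. Unset Strict Implicit. Unset Printing Implicit Defensive.
Import Order.TTheory GRing.Theory Num.Theory.
Local Open Scope ring_scope.

(* A vertex of {0,1}^n is v : {ffun 'I_n -> bool}; coordinate x_c (1 <= c <= n)
   is v (c-1).  [emb v] is the 1-indexed 0/1 integer vector, 0 outside 1..n. *)
Definition emb (n : nat) (v : {ffun 'I_n -> bool}) : nat -> int :=
  fun c => if c is c'.+1 then oapp (fun i : 'I_n => ((v i : bool) : nat)%:Z) 0 (insub c')
           else 0.

Definition cube_max (n : nat) (f : (nat -> int) -> int) : int :=
  \big[Order.max/f (emb [ffun _ : 'I_n => false])]_(v : {ffun 'I_n -> bool}) f (emb v).
Definition cube_min (n : nat) (f : (nat -> int) -> int) : int :=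
  \big[Order.min/f (emb [ffun _ : 'I_n => false])]_(v : {ffun 'I_n -> bool}) f (emb v).

(* gk k = g_{4k+2}, a function of x_1, ..., x_{4k+2} *)
Fixpoint gk (k : nat) : (nat -> int) -> int :=
  match k with
  | 0%N => fun x => 2 * x 1%N + x 2%N
  | k'.+1 =>
      let g := gk k' in
      let n := (4 * k' + 2)%N in
      let M := 4 * (cube_max n g - cube_min n g) in
      fun x =>
        4 * g x + 3 * x n.+1
        - \sum_(1 <= i < n.+1) (2 * M + i%:Z + 2) * x i * x n.+2
        + 3 * M * n%:Z * x n.+1 * x n.+2
        + 2 * x n.+3
        + M * x n.+1 * x n.+3
        - 4 * M * n%:Z * x n.+2 * x n.+4
        + 5 * M * n%:Z * x n.+3 * x n.+4
  end.

Definition g (n : nat) (v : {ffun 'I_n -> bool}) : int := gk (n %/ 4) (emb v).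

Definition flip (n : nat) (i : 'I_n) (v : {ffun 'I_n -> bool}) : {ffun 'I_n -> bool} :=
  [ffun j => if j == i then ~~ v j else v j].

Definition is_local_max (n : nat) (f : {ffun 'I_n -> bool} -> int) (v : {ffun 'I_n -> bool}) :=
  forall i : 'I_n, f (flip i v) <= f v.

Definition greedy_step_unique (n : nat) (f : {ffun 'I_n -> bool} -> int)
    (v u : {ffun 'I_n -> bool}) :=
  [/\ exists i : 'I_n, u = flip i v,
      f v < f u &
      forall i : 'I_n, flip i v != u -> f (flip i v) < f u].

(* p = [:: v_0; v_1; ...; v_L] is the greedy local search path from v_0 with
   no ties at any step, ending at a local maximum (length L = size p - 1). *)
Definition greedy_path_no_ties (n : nat) (f : {ffun 'I_n -> bool} -> int)
    (p : seq {ffun 'I_n -> bool}) :=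
  [/\ (0 < size p)%N,
      forall t : nat, (t.+1 < size p)%N ->
        greedy_step_unique f (nth [ffun=> false] p t) (nth [ffun=> false] p t.+1)
    & is_local_max f (last [ffun=> false] p)].

(* complement of the characteristic vector of {4,8,...,n-2} (1-indexed) *)
Definition target (n : nat) : {ffun 'I_n -> bool} :=
  [ffun i : 'I_n => ~~ ((4 %| i.+1) && (i.+1 <= n - 2))%N].

(* Main.v *)
Require Import Defs.
From mathcomp Require Import all_boot all_order all_algebra.
From mathcomp Require Import zify ring lra.
From Stdlib Require Import FunctionalExtensionality.
Import Order.TTheory GRing.Theory Num.Theory.
Local Open Scope ring_scope.
Set Implicit Arguments. Unset Strict Implicit.

(* Write n = 4k+2 and M = M_n.  While x_(n+2) = 0, the function g_(n+4) sees
   the lower block x_1..x_n only through 4 g_n, so greedy search from 0 first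
   retraces the greedy path of g_n up to its peak.  It then sets x_(n+1) and
   x_(n+2); from now on every set lower bit i costs 2M + i + 2, more than any
   gain in 4 g_n, so greedy switches the whole lower block off again, in an
   order that has to be carried through the induction (a "clearing walk").
   Finally it sets x_(n+3) and x_(n+4), unsets x_(n+2) and climbs g_n a second
   time.  The path length thus at least doubles with each level, starting from
   2 for g_2.  The same decomposition gives uniqueness of the local maximum:
   there x_(n+2) = 0, so the lower block is a local maximum of g_n, and the
   upper block is forced to be 1,0,1,1. *)

(* Points of the cube are handled as 1-indexed bit sequences [nat -> bool];
   only the coordinates [1..N] matter ([agree N]).  This lets the cubes of all
   dimensions 4k+2 share their points. *)
Definition bits := nat -> bool.
Definition zero_bits : bits := fun=> false.
Definition toggle (c : nat) (x : bits) : bits := fun d => if d == c then ~~ x d else x d.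
Definition bit (x : bits) (c : nat) : int := (x c : nat)%:Z.
Definition is_coord (N c : nat) : bool := (0 < c <= N)%N.
Definition agree (N : nat) (x y : bits) := forall c, is_coord N c -> x c = y c.

Lemma toggleC c d x : toggle c (toggle d x) = toggle d (toggle c x).
Proof.
by apply: functional_extensionality => e; rewrite /toggle; case: (e == c); case: (e == d).
Qed.

Lemma toggle_at c x : toggle c x c = ~~ x c.
Proof. by rewrite /toggle eqxx. Qed.

Lemma toggle_off c x d : d != c -> toggle c x d = x d.
Proof. by rewrite /toggle => /negbTE ->. Qed.

Lemma bit_toggle_at c x : bit (toggle c x) c = 1 - bit x c.
Proof. by rewrite /bit toggle_at; case: (x c). Qed.

Lemma bit_toggle_off c x d : d != c -> bit (toggle c x) d = bit x d.
Proof. by move=> ?; rewrite /bit toggle_off. Qed.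

Lemma bitT (x : bits) d : x d -> bit x d = 1.
Proof. by rewrite /bit => ->. Qed.

Lemma bitF (x : bits) d : x d = false -> bit x d = 0.
Proof. by rewrite /bit => ->. Qed.

Lemma bit_ge0 x d : 0 <= bit x d. Proof. by rewrite /bit; case: (x d). Qed.

Lemma bit_le1 x d : bit x d <= 1. Proof. by rewrite /bit; case: (x d). Qed.

Lemma agree_toggle N c x y : agree N x y -> agree N (toggle c x) (toggle c y).
Proof. by move=> h d hd; rewrite /toggle h. Qed.

Lemma agree_toggle_high N c x : (N < c)%N -> agree N (toggle c x) x.
Proof. by move=> hc d; rewrite /is_coord => hd; rewrite toggle_off //; lia. Qed.

Fixpoint walk (x : bits) (js : seq nat) : bits :=
  if js is j :: js' then walk (toggle j x) js' else x.

Fixpoint trace (x : bits) (js : seq nat) : seq bits :=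
  if js is j :: js' then x :: trace (toggle j x) js' else [:: x].

Lemma walk_cat x js1 js2 : walk x (js1 ++ js2) = walk (walk x js1) js2.
Proof. by elim: js1 x => //= j js IH x; rewrite IH. Qed.

Lemma walk_toggle c x js : c \notin js -> walk (toggle c x) js = toggle c (walk x js).
Proof.
elim: js x => //= j js IH x; rewrite in_cons negb_or => /andP[_ ?].
by rewrite toggleC IH.
Qed.

Lemma walk_toggle_outside N c x js : all (is_coord N) js -> (N < c)%N ->
  walk (toggle c x) js = toggle c (walk x js).
Proof.
move=> /allP hjs hc; apply: walk_toggle; apply/negP => /hjs.
by rewrite /is_coord; lia.
Qed.

Lemma size_trace x js : size (trace x js) = (size js).+1.
Proof. by elim: js x => //= j js IH x; rewrite IH. Qed.

Lemma last_trace y x js : last y (trace x js) = walk x js.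
Proof. by elim: js x y => //= j js IH x y; rewrite IH. Qed.

Section GreedyWalks.
Variables (f : bits -> int) (N : nat).

Definition greedy_move (x : bits) (j : nat) := [/\ is_coord N j, f x < f (toggle j x) &
  forall i, is_coord N i -> i != j -> f (toggle i x) < f (toggle j x)].

Fixpoint greedy_walk (x : bits) (js : seq nat) : Prop :=
  if js is j :: js' then greedy_move x j /\ greedy_walk (toggle j x) js' else True.

Definition local_max (x : bits) := forall i, is_coord N i -> f (toggle i x) <= f x.

Definition loss (x : bits) (i : nat) := f x - f (toggle i x).

(* Greedy search one level up follows such a walk: there the loss of each
   lower bit counts four times (the [4 g_n] term) against a reward growing with
   its index.  Quantifying over all weights [w] lets this survive the next
   levels. *)
Definition clearing_move (K : int) (x : bits) (j : nat) :=
  [/\ is_coord N j, x j, loss x j <= K &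
    forall (w : int) i, 1 <= w -> is_coord N i -> i != j -> x i ->
      w * loss x j - j%:Z < w * loss x i - i%:Z].

Fixpoint clearing_walk (K : int) (x : bits) (js : seq nat) : Prop :=
  if js is j :: js' then clearing_move K x j /\ clearing_walk K (toggle j x) js' else True.

Lemma greedy_walk_cat x js1 js2 :
  greedy_walk x js1 -> greedy_walk (walk x js1) js2 -> greedy_walk x (js1 ++ js2).
Proof. by elim: js1 x => //= j js IH x [? ?] ?; split=> //; apply: IH. Qed.

Lemma clearing_walk_cat K x js1 js2 :
  clearing_walk K x js1 -> clearing_walk K (walk x js1) js2 ->
  clearing_walk K x (js1 ++ js2).
Proof. by elim: js1 x => //= j js IH x [? ?] ?; split=> //; apply: IH. Qed.

Lemma greedy_walk_coords x js : greedy_walk x js -> all (is_coord N) js.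
Proof. by elim: js x => //= j js IH x [[-> _ _] /IH]. Qed.

Lemma clearing_walk_coords K x js : clearing_walk K x js -> all (is_coord N) js.
Proof. by elim: js x => //= j js IH x [[-> _ _ _] /IH]. Qed.

Lemma greedy_walk_mono x js : greedy_walk x js -> f x <= f (walk x js).
Proof. by elim: js x => //= j js IH x [[_ /ltW h _] /IH]; apply: le_trans. Qed.

Lemma greedy_walk_nth y0 x js t : greedy_walk x js -> (t < size js)%N ->
  greedy_move (nth y0 (trace x js) t) (nth 0%N js t) /\
  nth y0 (trace x js) t.+1 = toggle (nth 0%N js t) (nth y0 (trace x js) t).
Proof.
elim: js x t => //= j js IH x [|t] [? ?] ht //=; first by case: (js).
exact: IH.
Qed.

Hypothesis f_local : forall x y, agree N x y -> f x = f y.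

Lemma greedy_walk_agree x y js : agree N x y -> greedy_walk x js -> greedy_walk y js.
Proof.
elim: js x y => //= j js IH x y hxy [[hj hup hbest] ?]; split; last first.
  by apply: (IH (toggle j x)) => //; apply: agree_toggle.
have ej := f_local (agree_toggle j hxy).
split=> //; first by rewrite -(f_local hxy) -ej.
by move=> i ? ?; rewrite -ej -(f_local (agree_toggle i hxy)); apply: hbest.
Qed.

Lemma local_max_agree x y : agree N x y -> local_max x -> local_max y.
Proof.
by move=> hxy h i ?; rewrite -(f_local hxy) -(f_local (agree_toggle i hxy)); apply: h.
Qed.

End GreedyWalks.

Definition cube_dim (k : nat) : nat := (4 * k + 2)%N.
Definition G (k : nat) (x : bits) : int := gk k (bit x).
Definition Mk (k : nat) : int :=
  4 * (cube_max (cube_dim k) (gk k) - cube_min (cube_dim k) (gk k)).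

(* the sum multiplying [- x_(n+2)] in [g_(n+4)] *)
Definition penalty (k : nat) (x : bits) : int :=
  \sum_(1 <= i < (cube_dim k).+1) (2 * Mk k + i%:Z + 2) * bit x i.

Lemma cube_dim_ge2 k : 2 <= (cube_dim k)%:Z.
Proof. rewrite /cube_dim; lia. Qed.

Lemma cube_dimS k : cube_dim k.+1 = (cube_dim k).+4.
Proof. rewrite /cube_dim; lia. Qed.

Lemma gk_local k (x y : nat -> int) :
  (forall c, is_coord (cube_dim k) c -> x c = y c) -> gk k x = gk k y.
Proof.
elim: k x y => [|k IH] x y h; first by rewrite /= !h.
have hy c : (0 < c <= (cube_dim k).+4)%N -> x c = y c by rewrite -cube_dimS; apply: h.
have hsum : \sum_(1 <= i < (cube_dim k).+1) (2 * Mk k + i%:Z + 2) * x i * x (cube_dim k).+2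
    = \sum_(1 <= i < (cube_dim k).+1) (2 * Mk k + i%:Z + 2) * y i * y (cube_dim k).+2.
  by apply: eq_big_nat => i hi; rewrite !hy //; lia.
rewrite /= (IH x y); last by move=> c; rewrite /is_coord => hc; apply: hy; lia.
rewrite -/(cube_dim k) -/(Mk k) hsum !hy //; lia.
Qed.

Lemma G_local k x y : agree (cube_dim k) x y -> G k x = G k y.
Proof. by move=> h; apply: gk_local => c hc; rewrite /bit h. Qed.

Lemma le_bigmax_fin (d : Order.disp_t) (T : orderType d) (I : finType) (F : I -> T) x0 v :
  (F v <= \big[Order.max/x0]_(u : I) F u)%O.
Proof.
apply: le_trans (sub_bigmax_seq (x0 := x0) (r := [:: v]) predT F _) => [|u].
  by rewrite big_cons big_nil le_max lexx.
by rewrite inE => /eqP ->; rewrite mem_index_enum.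
Qed.

Lemma bigmin_le_fin (d : Order.disp_t) (T : orderType d) (I : finType) (F : I -> T) x0 v :
  (\big[Order.min/x0]_(u : I) F u <= F v)%O.
Proof.
apply: le_trans (sub_bigmin_seq (x0 := x0) (r' := [:: v]) predT F _) _ => [u|].
  by rewrite inE => /eqP ->; rewrite mem_index_enum.
by rewrite big_cons big_nil ge_min lexx.
Qed.

Definition cube_point (n : nat) (x : bits) : {ffun 'I_n -> bool} := [ffun i : 'I_n => x i.+1].

Lemma emb_cube_point n x c : is_coord n c -> emb (cube_point n x) c = bit x c.
Proof. by case: c => // c hc; rewrite /= insubT /= ffunE. Qed.

Lemma gk_cube_point k x : gk k (emb (cube_point (cube_dim k) x)) = G k x.
Proof. by apply: gk_local => c hc; rewrite emb_cube_point. Qed.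

Lemma gap_le_Mk k x y : 4 * (G k x - G k y) <= Mk k.
Proof.
rewrite /Mk ler_pM2l // -(gk_cube_point k x) -(gk_cube_point k y) lerB //.
  exact: (le_bigmax_fin (fun v => gk k (emb v))).
exact: (bigmin_le_fin (fun v => gk k (emb v))).
Qed.

Section Decomposition.
Variable k : nat.
Local Notation n := (cube_dim k).
Local Notation M := (Mk k).

Lemma G_succ x : G k.+1 x = 4 * G k x + 3 * bit x n.+1 - penalty k x * bit x n.+2
  + 3 * M * n%:Z * bit x n.+1 * bit x n.+2 + 2 * bit x n.+3 + M * bit x n.+1 * bit x n.+3
  - 4 * M * n%:Z * bit x n.+2 * bit x n.+4 + 5 * M * n%:Z * bit x n.+3 * bit x n.+4.
Proof. by rewrite /G /= /penalty big_distrl. Qed.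

Lemma G_toggle_high c x : (n < c)%N -> G k (toggle c x) = G k x.
Proof. by move=> hc; apply/G_local/agree_toggle_high. Qed.

Lemma penalty_toggle_high c x : (n < c)%N -> penalty k (toggle c x) = penalty k x.
Proof. by move=> hc; apply: eq_big_nat => i hi; rewrite bit_toggle_off //; lia. Qed.

Lemma penalty_toggle_low c x : is_coord n c ->
  penalty k (toggle c x) = penalty k x + (1 - 2 * bit x c) * (2 * M + c%:Z + 2).
Proof.
move=> hc; rewrite /penalty.
have -> : \sum_(1 <= i < n.+1) (2 * M + i%:Z + 2) * bit (toggle c x) i =
  \sum_(1 <= i < n.+1) ((2 * M + i%:Z + 2) * bit x i +
     (if i == c then (1 - 2 * bit x c) * (2 * M + c%:Z + 2) else 0)).
  apply: eq_big_nat => i _; case: eqP => [->|/eqP ?].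
    by rewrite bit_toggle_at; ring.
  by rewrite bit_toggle_off // addr0.
by rewrite big_split /= -big_mkcond big_nat1_eq ltnS -[(_ <= _ <= _)%N]/(is_coord n c) hc.
Qed.

Lemma penalty_ge0 x : 0 <= M -> 0 <= penalty k x.
Proof.
move=> hM; apply: sumr_ge0 => i _; apply: mulr_ge0 (bit_ge0 _ _).
have := bit_ge0 x i; lia.
Qed.

Lemma penalty_le x : 0 <= M -> penalty k x <= n%:Z * (2 * M + n%:Z + 2).
Proof.
move=> hM; apply: (le_trans (y := \sum_(1 <= i < n.+1) (2 * M + n%:Z + 2))).
  apply: ler_sum_nat => i /andP[h1 h2].
  have := bit_ge0 x i; have := bit_le1 x i.
  have : i%:Z <= n%:Z by rewrite lez_nat; lia.
  nia.
by rewrite sumr_const_nat subSS subn0 -[X in X <= _]mulr_natl natz.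
Qed.

Lemma penalty_zero x : (forall i, is_coord n i -> x i = false) -> penalty k x = 0.
Proof.
by move=> h; rewrite /penalty big1_seq // => i; rewrite mem_index_iota => ?; rewrite bitF ?mulr0 ?h.
Qed.

Lemma G_succ_toggle_low c x : is_coord n c -> G k.+1 (toggle c x) = G k.+1 x
  + 4 * (G k (toggle c x) - G k x) - bit x n.+2 * (1 - 2 * bit x c) * (2 * M + c%:Z + 2).
Proof.
move=> hc; have ne d : (n < d)%N -> d != c by move: hc; rewrite /is_coord; lia.
rewrite !G_succ penalty_toggle_low // !bit_toggle_off; try by apply: ne; lia.
ring.
Qed.

Lemma G_succ_toggle_low0 c (x : bits) : is_coord n c -> x n.+2 = false ->
  G k.+1 (toggle c x) = G k.+1 x + 4 * (G k (toggle c x) - G k x).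
Proof. by move=> hc h2; rewrite G_succ_toggle_low // bitF //; ring. Qed.

Lemma G_succ_toggle_low1 c (x : bits) : is_coord n c -> x n.+2 ->
  G k.+1 (toggle c x) = G k.+1 x - 4 * loss (G k) x c - (1 - 2 * bit x c) * (2 * M + c%:Z + 2).
Proof. by move=> hc h2; rewrite G_succ_toggle_low // bitT // /loss; ring. Qed.

Ltac toggle_high := rewrite !G_succ G_toggle_high ?penalty_toggle_high ?bit_toggle_at
  ?bit_toggle_off //; try lia; ring.

Lemma G_succ_toggle1 x : G k.+1 (toggle n.+1 x) = G k.+1 x
  + (1 - 2 * bit x n.+1) * (3 + 3 * M * n%:Z * bit x n.+2 + M * bit x n.+3).
Proof. toggle_high. Qed.

Lemma G_succ_toggle2 x : G k.+1 (toggle n.+2 x) = G k.+1 x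
  + (1 - 2 * bit x n.+2) * (- penalty k x + 3 * M * n%:Z * bit x n.+1 - 4 * M * n%:Z * bit x n.+4).
Proof. toggle_high. Qed.

Lemma G_succ_toggle3 x : G k.+1 (toggle n.+3 x) = G k.+1 x
  + (1 - 2 * bit x n.+3) * (2 + M * bit x n.+1 + 5 * M * n%:Z * bit x n.+4).
Proof. toggle_high. Qed.

Lemma G_succ_toggle4 x : G k.+1 (toggle n.+4 x) = G k.+1 x
  + (1 - 2 * bit x n.+4) * (- 4 * M * n%:Z * bit x n.+2 + 5 * M * n%:Z * bit x n.+3).
Proof. toggle_high. Qed.

End Decomposition.

Definition peak (k : nat) : bits :=
  fun c => ((0 < c <= cube_dim k) && ~~ ((4 %| c) && (c <= 4 * k)))%N.

Lemma peak_high k d : (cube_dim k < d)%N -> peak k d = false.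
Proof. by rewrite /peak /cube_dim; lia. Qed.

Lemma peak_low k d : (d <= cube_dim k)%N -> peak k.+1 d = peak k d.
Proof. by rewrite /peak /cube_dim; lia. Qed.

Lemma peakS k :
  peak k.+1 = toggle (cube_dim k).+4 (toggle (cube_dim k).+3 (toggle (cube_dim k).+1 (peak k))).
Proof.
apply: functional_extensionality => d; rewrite /toggle /peak /cube_dim.
by case: eqP => ?; case: eqP => ?; case: eqP => ?; lia.
Qed.

Definition high_zero k (x : bits) := [/\ x (cube_dim k).+1 = false, x (cube_dim k).+2 = false,
  x (cube_dim k).+3 = false & x (cube_dim k).+4 = false].
Definition high_peak k (x : bits) :=
  [/\ x (cube_dim k).+1, x (cube_dim k).+2 = false, x (cube_dim k).+3 & x (cube_dim k).+4].

Lemma high_zero_zero k : high_zero k zero_bits.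
Proof. by []. Qed.

Lemma high_peak_peak k : high_peak k (peak k.+1).
Proof. by rewrite /high_peak /peak /cube_dim; split; lia. Qed.

Lemma Mk_succ_ge k : G k zero_bits <= G k (peak k) ->
  20 + 4 * Mk k + 20 * Mk k * (cube_dim k)%:Z <= Mk k.+1.
Proof.
move=> hz; have := gap_le_Mk k.+1 (peak k.+1) zero_bits.
have -> : G k.+1 (peak k.+1) = 4 * G k (peak k) + 5 + Mk k + 5 * Mk k * (cube_dim k)%:Z.
  have [h1 h2 h3 h4] := high_peak_peak k.
  rewrite G_succ (bitT h1) (bitF h2) (bitT h3) (bitT h4) (_ : G k (peak k.+1) = G k (peak k)).
    by ring.
  by apply: G_local => d; rewrite /is_coord => hd; apply: peak_low; lia.
by rewrite G_succ penalty_zero // !bitF //; lia.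
Qed.

Ltac eval_bits := rewrite /bit /toggle /zero_bits; repeat (case: eqP => ?; try (exfalso; lia)).

Section Step.
Variable k : nat.
Local Notation n := (cube_dim k).
Local Notation M := (Mk k).

Lemma coord_succ_split i : is_coord n.+4 i ->
  is_coord n i \/ i = n.+1 \/ i = n.+2 \/ i = n.+3 \/ i = n.+4.
Proof. rewrite /is_coord; lia. Qed.

Lemma is_coord_succ i : is_coord n i -> is_coord n.+4 i.
Proof. rewrite /is_coord; lia. Qed.

Lemma toggle_low_at_high j x d : is_coord n j -> (n < d)%N -> toggle j x d = x d.
Proof. by move=> hj hd; rewrite toggle_off //; move: hj; rewrite /is_coord; lia. Qed.

Lemma high_zero_toggle j x : is_coord n j -> high_zero k x -> high_zero k (toggle j x).
Proof. by move=> hj; rewrite /high_zero !toggle_low_at_high //; lia. Qed.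

Lemma high_peak_toggle j x : is_coord n j -> high_peak k x -> high_peak k (toggle j x).
Proof. by move=> hj; rewrite /high_peak !toggle_low_at_high //; lia. Qed.

Definition low_zero (x : bits) := forall d, is_coord n d -> x d = false.

Lemma low_zero_toggle_high c x : (n < c)%N -> low_zero x -> low_zero (toggle c x).
Proof. by move=> hc hx d hd; rewrite toggle_off ?hx //; move: hd; rewrite /is_coord; lia. Qed.

Lemma low_zero_set x i : low_zero x -> is_coord n.+4 i -> x i ->
  i = n.+1 \/ i = n.+2 \/ i = n.+3 \/ i = n.+4.
Proof.
move=> hx hi hxi; case: (coord_succ_split hi) => [hi'|//].
by rewrite hx in hxi.
Qed.

Definition cleared_state : bits := toggle n.+2 (toggle n.+1 zero_bits).

Lemma low_zero_cleared : low_zero cleared_state.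
Proof. by do 2!apply: low_zero_toggle_high => //. Qed.

Definition peak_top (y : bits) : bits := toggle n.+4 (toggle n.+3 (toggle n.+1 y)).

Lemma high_peak_top y : high_zero k y -> high_peak k (peak_top y).
Proof. by case=> h1 h2 h3 h4; rewrite /high_peak /peak_top; eval_bits; rewrite h1 h2 h3 h4. Qed.

Lemma agree_peak_top y : agree n (peak_top y) y.
Proof. by move=> d; rewrite /is_coord => hd; rewrite /peak_top !toggle_off //; apply/eqP; lia. Qed.

Lemma low_zero_peak_top : low_zero (peak_top zero_bits).
Proof. by move=> d; rewrite /is_coord => hd; rewrite /peak_top; eval_bits. Qed.

Lemma high_zero_peak : high_zero k (peak k).
Proof. by split; apply: peak_high; lia. Qed.

Lemma walk_peak_top y js : all (is_coord n) js -> walk (peak_top y) js = peak_top (walk y js).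
Proof. by move=> hjs; rewrite /peak_top !(@walk_toggle_outside n) //; lia. Qed.

Lemma walk_cleared : walk cleared_state [:: n.+3; n.+4; n.+2] = peak_top zero_bits.
Proof.
by apply: functional_extensionality => d /=; rewrite /cleared_state /peak_top; eval_bits.
Qed.

Lemma walk_top : walk (peak_top zero_bits) [:: n.+1; n.+4; n.+3] = zero_bits.
Proof. by apply: functional_extensionality => d /=; rewrite /peak_top; eval_bits; lia. Qed.

Lemma loss_high_peak x : high_peak k x -> [/\ loss (G k.+1) x n.+1 = 3 + M,
  loss (G k.+1) x n.+3 = 2 + M + 5 * M * n%:Z & loss (G k.+1) x n.+4 = 5 * M * n%:Z].
Proof.
case=> h1 h2 h3 h4; rewrite /loss G_succ_toggle1 G_succ_toggle3 G_succ_toggle4.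
by rewrite (bitT h1) (bitF h2) (bitT h3) (bitT h4); split; ring.
Qed.

Hypothesis M_large : n%:Z ^+ 2 + 2 * n%:Z + 2 < M * (n%:Z - 1).

Lemma M_ge : n%:Z + 3 <= M.
Proof. have := cube_dim_ge2 k; move: M_large; rewrite expr2; nia. Qed.

(* While [x_(n+2) = 0] the lower block sees [4 g_n]: greedy steps of [g_n] lift. *)
Lemma greedy_move_lift x j : greedy_move (G k) n x j ->
  high_zero k x \/ high_peak k x -> greedy_move (G k.+1) n.+4 x j.
Proof.
case=> hj hgt hbest hp.
have h2 : x n.+2 = false by case: hp => -[].
have hlo i : is_coord n i -> G k.+1 (toggle i x) = G k.+1 x + 4 * (G k (toggle i x) - G k x).
  by move=> hi; rewrite G_succ_toggle_low0.
have := penalty_ge0 x (le_trans _ M_ge); have := cube_dim_ge2 k => hn hS.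
split; [exact: is_coord_succ | by rewrite hlo //; lia |].
move=> i hi hij; rewrite (hlo j hj).
case: (coord_succ_split hi) => [hi'|[->|[->|[->|->]]]].
- by rewrite hlo //; have := hbest i hi' hij; lia.
all: rewrite ?G_succ_toggle1 ?G_succ_toggle2 ?G_succ_toggle3 ?G_succ_toggle4.
all: case: hp => -[h1 h2' h3 h4]; rewrite ?(bitF h1) ?(bitT h1) ?(bitF h2')
  ?(bitF h3) ?(bitT h3) ?(bitF h4) ?(bitT h4); nia.
Qed.

Lemma greedy_walk_lift js x : greedy_walk (G k) n x js ->
  high_zero k x \/ high_peak k x -> greedy_walk (G k.+1) n.+4 x js.
Proof.
elim: js x => //= j js IH x [hj hjs] hp; split; first exact: greedy_move_lift.
apply: IH => //; case: hj => hj _ _.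
by case: hp => ?; [left; apply: high_zero_toggle | right; apply: high_peak_toggle].
Qed.

Lemma local_max_lift x : local_max (G k) n x -> high_peak k x -> local_max (G k.+1) n.+4 x.
Proof.
move=> hl [h1 h2 h3 h4] i hi.
have := penalty_ge0 x (le_trans _ M_ge); have := cube_dim_ge2 k => hn hS.
case: (coord_succ_split hi) => [hi'|[->|[->|[->|->]]]].
- by rewrite G_succ_toggle_low0 //; have := hl i hi'; lia.
all: rewrite ?G_succ_toggle1 ?G_succ_toggle2 ?G_succ_toggle3 ?G_succ_toggle4.
all: rewrite ?(bitT h1) ?(bitF h2) ?(bitT h3) ?(bitT h4); nia.
Qed.

Lemma greedy_move_set1 x : local_max (G k) n x -> high_zero k x ->
  greedy_move (G k.+1) n.+4 x n.+1.
Proof.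
move=> hl [h1 h2 h3 h4].
have := penalty_ge0 x (le_trans _ M_ge); have := cube_dim_ge2 k => hn hS.
rewrite /greedy_move G_succ_toggle1 (bitF h1) (bitF h2) (bitF h3).
split; [by rewrite /is_coord; lia | lia |].
move=> i hi hij; case: (coord_succ_split hi) => [hi'|[e|[->|[->|->]]]].
- by rewrite G_succ_toggle_low0 //; have := hl i hi'; lia.
- by rewrite e eqxx in hij.
all: rewrite ?G_succ_toggle2 ?G_succ_toggle3 ?G_succ_toggle4.
all: rewrite ?(bitF h1) ?(bitF h2) ?(bitF h3) ?(bitF h4); nia.
Qed.

(* The reward [3 M n] for setting [x_(n+2)] beats any penalty. *)
Lemma greedy_move_set2 x : local_max (G k) n x -> high_zero k x ->
  greedy_move (G k.+1) n.+4 (toggle n.+1 x) n.+2.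
Proof.
move=> hl [h1 h2 h3 h4]; set y := toggle n.+1 x.
have hM := M_ge; have hn := cube_dim_ge2 k.
have hS1 := penalty_ge0 y (le_trans _ hM); have hS2 := penalty_le y (le_trans _ hM).
have e1 : bit y n.+1 = 1 by rewrite /y bit_toggle_at (bitF h1).
have [e2 e3 e4] : [/\ bit y n.+2 = 0, bit y n.+3 = 0 & bit y n.+4 = 0].
  by rewrite /y !bit_toggle_off ?bitF //; apply/eqP; lia.
have := M_large; rewrite expr2 => hMn.
have key : n%:Z * (2 * M + n%:Z + 2) + M + 2 < 3 * M * n%:Z by nia.
rewrite /greedy_move G_succ_toggle2 e1 e2 e4.
split; [by rewrite /is_coord; lia | nia |].
move=> i hi hij; case: (coord_succ_split hi) => [hi'|[->|[e|[->|->]]]].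
- have agy : agree n y x by apply: agree_toggle_high.
  have y2 : y n.+2 = false by rewrite /y toggle_off //; apply/eqP; lia.
  rewrite G_succ_toggle_low0 // (G_local agy) (G_local (agree_toggle i agy)).
  by have := hl i hi'; nia.
- by rewrite G_succ_toggle1 e1 e2 e3; nia.
- by rewrite e eqxx in hij.
- by rewrite G_succ_toggle3 e1 e3 e4; nia.
- by rewrite G_succ_toggle4 e2 e3 e4; nia.
Qed.

(* With [x_(n+2) = 1] every set lower bit [i] costs [2 M + i + 2], more than
   four times any loss in [g_n]: greedy switches the lower block off, in the
   order prescribed by a clearing walk. *)
Lemma greedy_walk_clear K us y : 4 * K + n%:Z + 1 <= M -> clearing_walk (G k) n K y us ->
  high_zero k y -> greedy_walk (G k.+1) n.+4 (toggle n.+2 (toggle n.+1 y)) us.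
Proof.
move=> hK; elim: us y => //= j us IH y [[hj hyj hloss hmin] hus] hy; split; last first.
  by rewrite (toggleC j) (toggleC j); apply: IH => //; apply: high_zero_toggle.
set x := toggle n.+2 (toggle n.+1 y).
have hM := M_ge; have hn := cube_dim_ge2 k.
have [e1 e2 e3 e4] : [/\ bit x n.+1 = 1, bit x n.+2 = 1, bit x n.+3 = 0 & bit x n.+4 = 0].
  by case: hy => h1 h2 h3 h4; rewrite /x; eval_bits; rewrite ?h1 ?h2 ?h3 ?h4.
have agx : agree n x y.
  by move=> d; rewrite /is_coord => hd; rewrite /x !toggle_off //; apply/eqP; lia.
have hlo i : is_coord n i -> G k.+1 (toggle i x) =
    G k.+1 x - 4 * loss (G k) y i - (1 - 2 * bit y i) * (2 * M + i%:Z + 2).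
  move=> hi; rewrite G_succ_toggle_low1 /loss ?(G_local agx) ?(G_local (agree_toggle i agx)) //.
    by rewrite /bit (agx i hi).
  by move: e2; rewrite /bit; case: (x n.+2).
have hS1 := penalty_ge0 x (le_trans _ hM); have hS2 := penalty_le x (le_trans _ hM).
have hjn : (1 <= j%:Z) && (j%:Z <= n%:Z) by move: hj; rewrite /is_coord; lia.
have hgain : M + n%:Z + 3 < G k.+1 (toggle j x) - G k.+1 x by rewrite hlo // bitT //; lia.
split; [exact: is_coord_succ | lia |].
move=> i hi hij; case: (coord_succ_split hi) => [hi'|[->|[->|[->|->]]]].
- rewrite hlo //; case hyi: (y i).
    have := hmin 4 i (ler_nat _ 1 4) hi' hij hyi.
    by rewrite (bitT hyi) hlo // bitT //; lia.
  rewrite (bitF hyi) /loss; have := gap_le_Mk k (toggle i y) y; lia.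
- by rewrite G_succ_toggle1 e1 e2 e3; nia.
- by rewrite G_succ_toggle2 e1 e2 e4; nia.
- by rewrite G_succ_toggle3 e1 e3 e4; nia.
- by rewrite G_succ_toggle4 e2 e3 e4; nia.
Qed.

Lemma G_succ_toggle_low_lt x i : is_coord n i -> low_zero x -> x n.+2 ->
  G k.+1 (toggle i x) < G k.+1 x.
Proof.
move=> hi hx h2; rewrite G_succ_toggle_low1 // (bitF (hx i hi)) /loss.
have := gap_le_Mk k (toggle i x) x; have := M_ge; lia.
Qed.

(* On a zero lower block with [x_(n+2) = 1] only the four upper coordinates compete. *)
Lemma greedy_move_high x j : low_zero x -> x n.+2 -> (n < j <= n.+4)%N ->
  G k.+1 x < G k.+1 (toggle j x) ->
  (forall i, (n < i <= n.+4)%N -> i != j -> G k.+1 (toggle i x) < G k.+1 (toggle j x)) ->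
  greedy_move (G k.+1) n.+4 x j.
Proof.
move=> hx h2 hj hup hhigh; split=> [||i hi hij]; first by rewrite /is_coord; lia.
  exact: hup.
case: (coord_succ_split hi) => [hi'|hi']; last by apply: hhigh; lia.
exact: lt_trans (G_succ_toggle_low_lt hi' hx h2) hup.
Qed.

Lemma greedy_move_set3 : greedy_move (G k.+1) n.+4 cleared_state n.+3.
Proof.
set x := cleared_state; have hM := M_ge; have hn := cube_dim_ge2 k.
have [e1 e2 e3 e4] : [/\ bit x n.+1 = 1, bit x n.+2 = 1, bit x n.+3 = 0 & bit x n.+4 = 0].
  by rewrite /x /cleared_state; split; eval_bits.
apply: greedy_move_high;
  [exact: low_zero_cleared | by rewrite /x /cleared_state; eval_bits | lia | |].
  by rewrite G_succ_toggle3 e1 e3 e4; lia.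
move=> i hi /eqP hij; rewrite G_succ_toggle3 e1 e3 e4.
have [->|[->|->]] : i = n.+1 \/ i = n.+2 \/ i = n.+4 by lia.
- by rewrite G_succ_toggle1 e1 e2 e3; nia.
- by rewrite G_succ_toggle2 e1 e2 e4 (penalty_zero low_zero_cleared); nia.
- by rewrite G_succ_toggle4 e2 e3 e4; nia.
Qed.

Lemma greedy_move_set4 : greedy_move (G k.+1) n.+4 (toggle n.+3 cleared_state) n.+4.
Proof.
set x := toggle n.+3 cleared_state; have hM := M_ge; have hn := cube_dim_ge2 k.
have hx : low_zero x by apply: low_zero_toggle_high; [lia | exact: low_zero_cleared].
have [e1 e2 e3 e4] : [/\ bit x n.+1 = 1, bit x n.+2 = 1, bit x n.+3 = 1 & bit x n.+4 = 0].
  by rewrite /x /cleared_state; split; eval_bits.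
apply: greedy_move_high; [exact: hx | by rewrite /x /cleared_state; eval_bits | lia | |].
  by rewrite G_succ_toggle4 e2 e3 e4; nia.
move=> i hi /eqP hij; rewrite G_succ_toggle4 e2 e3 e4.
have [->|[->|->]] : i = n.+1 \/ i = n.+2 \/ i = n.+3 by lia.
- by rewrite G_succ_toggle1 e1 e2 e3; nia.
- by rewrite G_succ_toggle2 e1 e2 e4 (penalty_zero hx); nia.
- by rewrite G_succ_toggle3 e1 e3 e4; nia.
Qed.

Lemma greedy_move_unset2 :
  greedy_move (G k.+1) n.+4 (toggle n.+4 (toggle n.+3 cleared_state)) n.+2.
Proof.
set x := toggle n.+4 _; have hM := M_ge; have hn := cube_dim_ge2 k.
have hx : low_zero x.
  by apply: low_zero_toggle_high; [lia|apply: low_zero_toggle_high; [lia|exact: low_zero_cleared]].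
have [e1 e2 e3 e4] : [/\ bit x n.+1 = 1, bit x n.+2 = 1, bit x n.+3 = 1 & bit x n.+4 = 1].
  by rewrite /x /cleared_state; split; eval_bits.
apply: greedy_move_high; [exact: hx | by rewrite /x /cleared_state; eval_bits | lia | |].
  by rewrite G_succ_toggle2 e1 e2 e4 (penalty_zero hx); nia.
move=> i hi /eqP hij; rewrite G_succ_toggle2 e1 e2 e4 (penalty_zero hx).
have [->|[->|->]] : i = n.+1 \/ i = n.+3 \/ i = n.+4 by lia.
- by rewrite G_succ_toggle1 e1 e2 e3; nia.
- by rewrite G_succ_toggle3 e1 e3 e4; nia.
- by rewrite G_succ_toggle4 e2 e3 e4; nia.
Qed.

Definition succ_walk (js us : seq nat) :=
  js ++ [:: n.+1; n.+2] ++ us ++ [:: n.+3; n.+4; n.+2] ++ js.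

Lemma greedy_walk_succ js K us :
  greedy_walk (G k) n zero_bits js -> walk zero_bits js = peak k ->
  local_max (G k) n (peak k) -> 4 * K + n%:Z + 1 <= M ->
  clearing_walk (G k) n K (peak k) us -> walk (peak k) us = zero_bits ->
  greedy_walk (G k.+1) n.+4 zero_bits (succ_walk js us) /\
  walk zero_bits (succ_walk js us) = peak k.+1.
Proof.
move=> hjs hrun hmax hK hus hrun2.
have hjs_coords := greedy_walk_coords hjs; have hus_coords := clearing_walk_coords hus.
have hclear : walk (walk (peak k) [:: n.+1; n.+2]) us = cleared_state.
  by rewrite /= !(@walk_toggle_outside n) ?hrun2 //; lia.
split; last by rewrite !walk_cat hrun hclear walk_cleared walk_peak_top // hrun peakS.
apply: greedy_walk_cat; first by apply: greedy_walk_lift => //; left.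
rewrite hrun; apply: greedy_walk_cat.
  by split; [exact: greedy_move_set1 hmax high_zero_peak
             | split; [exact: greedy_move_set2 hmax high_zero_peak |]].
apply: greedy_walk_cat; first exact: greedy_walk_clear hK hus high_zero_peak.
rewrite hclear; apply: greedy_walk_cat.
  by split; [exact: greedy_move_set3
             | split; [exact: greedy_move_set4 | split; [exact: greedy_move_unset2 |]]].
rewrite walk_cleared; apply: greedy_walk_lift; last by right; apply/high_peak_top.
by apply: greedy_walk_agree hjs => // [x y|d hd]; [exact: G_local | rewrite agree_peak_top].
Qed.

(* The lower losses are multiplied by four, which the weight [w] absorbs; the
   upper bits lose at least [M > 4 K + n], so the lower bits keep precedence. *)
Lemma clearing_move_lift K y j : 0 <= K -> 4 * K + n%:Z + 1 <= M ->
  clearing_move (G k) n K y j -> high_zero k y ->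
  clearing_move (G k.+1) n.+4 (5 * M * n%:Z) (peak_top y) j.
Proof.
move=> hK0 hK [hj hyj hloss hmin] hy.
have hM := M_ge; have hn := cube_dim_ge2 k.
have hMn : 2 * M <= M * n%:Z by nia.
have [h1 h2 h3 h4] := high_peak_top hy; have ag := agree_peak_top y.
have [C1 C3 C4] := loss_high_peak (high_peak_top hy).
have Clo i : is_coord n i -> loss (G k.+1) (peak_top y) i = 4 * loss (G k) y i.
  move=> hi; rewrite /loss G_succ_toggle_low0 //.
  by rewrite (G_local ag) (G_local (agree_toggle i ag)); ring.
have hjn : j%:Z <= n%:Z by move: hj; rewrite /is_coord; lia.
split; [exact: is_coord_succ | by rewrite ag | by rewrite Clo //; nia |].
move=> w i hw hi hij hxi; rewrite Clo //.
have hp1 : 0 <= (w - 1) * (M - n%:Z - 1 - 4 * loss (G k) y j) by apply: mulr_ge0; lia.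
have hp2 : 0 <= (w - 1) * (n%:Z + 1) by apply: mulr_ge0; lia.
have hp3 : 0 <= (w - 1) * (5 * M * n%:Z - 3 - M) by apply: mulr_ge0; nia.
case: (coord_succ_split hi) => [hi'|[->|[e|[->|->]]]].
- have hyi : y i by rewrite -ag.
  by rewrite Clo //; have := hmin (4 * w) i ltac:(lia) hi' hij hyi; lia.
- by rewrite C1; nia.
- by move: hxi; rewrite e h2.
- by rewrite C3; nia.
- by rewrite C4; nia.
Qed.

Lemma clearing_walk_lift K us y : 0 <= K -> 4 * K + n%:Z + 1 <= M ->
  clearing_walk (G k) n K y us -> high_zero k y ->
  clearing_walk (G k.+1) n.+4 (5 * M * n%:Z) (peak_top y) us.
Proof.
move=> hK0 hK; elim: us y => //= j us IH y [hj hus] hy.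
split; first exact: clearing_move_lift hK0 hK hj hy.
have [hj' _ _ _] := hj.
by rewrite /peak_top (toggleC j) (toggleC j) (toggleC j); apply: IH => //; apply: high_zero_toggle.
Qed.

Lemma clearing_move_top1 :
  clearing_move (G k.+1) n.+4 (5 * M * n%:Z) (peak_top zero_bits) n.+1.
Proof.
have hM := M_ge; have hn := cube_dim_ge2 k; have hMn : 2 * M <= M * n%:Z by nia.
have [h1 h2 h3 h4] := high_peak_top (high_zero_zero k).
have [C1 C3 C4] := loss_high_peak (high_peak_top (high_zero_zero k)).
split; [by rewrite /is_coord; lia | done | by rewrite C1; nia |].
move=> w i hw hi /eqP hij /[dup] hxi /(low_zero_set low_zero_peak_top hi).
have hp : 0 <= (w - 1) * (5 * M * n%:Z - 3 - M) by apply: mulr_ge0; nia.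
case=> [|[|[|]]] ei; rewrite ei in hxi *; first by [].
- by rewrite h2 in hxi.
- by rewrite C1 C3; nia.
- by rewrite C1 C4; nia.
Qed.

Lemma clearing_move_top4 :
  clearing_move (G k.+1) n.+4 (5 * M * n%:Z) (toggle n.+1 (peak_top zero_bits)) n.+4.
Proof.
set x := toggle n.+1 _; have hM := M_ge; have hn := cube_dim_ge2 k.
have hx : low_zero x by apply: low_zero_toggle_high; [lia | exact: low_zero_peak_top].
have [e1 e2 e3 e4] : [/\ bit x n.+1 = 0, bit x n.+2 = 0, bit x n.+3 = 1 & bit x n.+4 = 1].
  by rewrite /x /peak_top; split; eval_bits.
have C4 : loss (G k.+1) x n.+4 = 5 * M * n%:Z by rewrite /loss G_succ_toggle4 e2 e3 e4; ring.
split; [by rewrite /is_coord; lia | by rewrite /x /peak_top; eval_bits | by rewrite C4 |].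
move=> w i hw hi /eqP hij /[dup] hxi /(low_zero_set hx hi).
case=> [|[|[|]]] ei; rewrite ei in hxi *.
- by move: hxi e1; rewrite /bit => ->.
- by move: hxi e2; rewrite /bit => ->.
- by rewrite C4 /loss G_succ_toggle3 e1 e3 e4; nia.
- by [].
Qed.

Lemma clearing_move_top3 : clearing_move (G k.+1) n.+4 (5 * M * n%:Z)
  (toggle n.+4 (toggle n.+1 (peak_top zero_bits))) n.+3.
Proof.
set x := toggle n.+4 _; have hM := M_ge; have hn := cube_dim_ge2 k.
have hx : low_zero x.
  apply: low_zero_toggle_high; first lia.
  by apply: low_zero_toggle_high; [lia | exact: low_zero_peak_top].
have [e1 e3 e4] : [/\ bit x n.+1 = 0, bit x n.+3 = 1 & bit x n.+4 = 0].
  by rewrite /x /peak_top; split; eval_bits.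
split; [by rewrite /is_coord; lia | by rewrite /x /peak_top; eval_bits | |].
  by rewrite /loss G_succ_toggle3 e1 e3 e4; nia.
move=> w i hw hi /eqP hij /[dup] hxi /(low_zero_set hx hi).
case=> [|[|[|]]] ei; rewrite ei in hxi *; try by [].
- by move: hxi e1; rewrite /bit => ->.
- by move: hxi; rewrite /x /peak_top; eval_bits.
- by move: hxi e4; rewrite /bit => ->.
Qed.

Lemma clearing_walk_top :
  clearing_walk (G k.+1) n.+4 (5 * M * n%:Z) (peak_top zero_bits) [:: n.+1; n.+4; n.+3].
Proof.
by split; [exact: clearing_move_top1
          | split; [exact: clearing_move_top4 | split; [exact: clearing_move_top3 |]]].
Qed.

Lemma clearing_walk_succ K us : 0 <= K -> 4 * K + n%:Z + 1 <= M ->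
  clearing_walk (G k) n K (peak k) us -> walk (peak k) us = zero_bits ->
  clearing_walk (G k.+1) n.+4 (5 * M * n%:Z) (peak k.+1) (us ++ [:: n.+1; n.+4; n.+3]) /\
  walk (peak k.+1) (us ++ [:: n.+1; n.+4; n.+3]) = zero_bits.
Proof.
move=> hK0 hK hus hrun; have hus_coords := clearing_walk_coords hus.
have hpeak : walk (peak k.+1) us = peak_top zero_bits by rewrite peakS walk_peak_top // hrun.
split; last by rewrite walk_cat hpeak walk_top.
apply: clearing_walk_cat.
  by rewrite peakS; exact: clearing_walk_lift hK0 hK hus high_zero_peak.
by rewrite hpeak; exact: clearing_walk_top.
Qed.

Lemma local_max_peak_succ : local_max (G k) n (peak k) -> local_max (G k.+1) n.+4 (peak k.+1).
Proof.
move=> hmax; apply: local_max_lift (high_peak_peak k).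
apply: local_max_agree hmax => // [x y|d]; first exact: G_local.
by rewrite /is_coord => hd; rewrite peak_low //; lia.
Qed.

(* At a local maximum [x_(n+2) = 0]: otherwise the lower block is zero, which
   forces [x_(n+3) = x_(n+4) = 1], and then unsetting [x_(n+2)] gains [M n]. *)
Lemma local_max_succ_unset2 x : local_max (G k.+1) n.+4 x -> x n.+2 = false.
Proof.
move=> hl; apply/negP => h2.
have hM := M_ge; have hn := cube_dim_ge2 k; have hMn : 2 * M <= M * n%:Z by nia.
have ba d : bit x d = 0 \/ bit x d = 1 by rewrite /bit; case: (x d); [right | left].
have hc c : (n < c <= n.+4)%N -> is_coord n.+4 c by rewrite /is_coord; lia.
have hlow : low_zero x.
  move=> i hi; apply/negP => hxi; have := hl i (is_coord_succ hi).
  by rewrite G_succ_toggle_low1 // (bitT hxi) /loss; have := gap_le_Mk k x (toggle i x); lia.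
have h3 : x n.+3.
  apply/negP => /negP/negbTE h3; have := hl _ (hc n.+3 ltac:(lia)).
  by rewrite G_succ_toggle3 (bitF h3); case: (ba n.+1) => ->; case: (ba n.+4) => ->; nia.
have h4 : x n.+4.
  apply/negP => /negP/negbTE h4; have := hl _ (hc n.+4 ltac:(lia)).
  by rewrite G_succ_toggle4 (bitF h4) (bitT h2) (bitT h3); nia.
have := hl _ (hc n.+2 ltac:(lia)); rewrite G_succ_toggle2 (penalty_zero hlow) (bitT h2) (bitT h4).
by case: (ba n.+1) => ->; nia.
Qed.

Lemma local_max_succ_agree_peak x :
  (forall y, local_max (G k) n y -> agree n y (peak k)) ->
  local_max (G k.+1) n.+4 x -> agree n.+4 x (peak k.+1).
Proof.
move=> IH hl; have h2 := local_max_succ_unset2 hl.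
have hM := M_ge; have hn := cube_dim_ge2 k; have hMn : 2 * M <= M * n%:Z by nia.
have hc c : (n < c <= n.+4)%N -> is_coord n.+4 c by rewrite /is_coord; lia.
have ba d : bit x d = 0 \/ bit x d = 1 by rewrite /bit; case: (x d); [right | left].
have hlk : local_max (G k) n x.
  by move=> i hi; have := hl i (is_coord_succ hi); rewrite G_succ_toggle_low0 //; lia.
have h1 : x n.+1.
  apply/negP => /negP/negbTE h1; have := hl _ (hc n.+1 ltac:(lia)).
  by rewrite G_succ_toggle1 (bitF h1) (bitF h2); case: (ba n.+3) => ->; nia.
have h3 : x n.+3.
  apply/negP => /negP/negbTE h3; have := hl _ (hc n.+3 ltac:(lia)).
  by rewrite G_succ_toggle3 (bitF h3) (bitT h1); case: (ba n.+4) => ->; nia.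
have h4 : x n.+4.
  apply/negP => /negP/negbTE h4; have := hl _ (hc n.+4 ltac:(lia)).
  by rewrite G_succ_toggle4 (bitF h4) (bitF h2) (bitT h3); nia.
have [p1 p2 p3 p4] := high_peak_peak k.
move=> c /coord_succ_split[hc'|[->|[->|[->|->]]]]; rewrite ?h1 ?h2 ?h3 ?h4 ?p1 ?p2 ?p3 ?p4 //.
rewrite peak_low; first exact: IH hlk c hc'.
by move: hc'; rewrite /is_coord; lia.
Qed.

Lemma Mk_succ_bounds : 20 + 4 * M + 20 * M * n%:Z <= Mk k.+1 ->
  4 * (5 * M * n%:Z) + (n.+4)%:Z + 1 <= Mk k.+1 /\
  (n.+4)%:Z ^+ 2 + 2 * (n.+4)%:Z + 2 < Mk k.+1 * ((n.+4)%:Z - 1).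
Proof.
have hM := M_ge; have hn := cube_dim_ge2 k => hM'; split; first lia.
have -> : (n.+4)%:Z = n%:Z + 4 by lia.
have h1 : 20 * (n%:Z * n%:Z) <= Mk k.+1 by nia.
have h2 : 20 * (n%:Z * n%:Z) * (n%:Z + 3) <= Mk k.+1 * (n%:Z + 3).
  by apply: ler_wpM2r => //; lia.
rewrite expr2; nia.
Qed.

End Step.

(* the induction hypothesis on [g_(4k+2)]; the clearing walk and the bounds on
   [Mk k] are what the step to [g_(4k+6)] needs *)
Definition level_invariant (k : nat) := [/\
  exists js, [/\ greedy_walk (G k) (cube_dim k) zero_bits js, walk zero_bits js = peak k
                & (2 ^ k.+1 <= size js)%N],
  local_max (G k) (cube_dim k) (peak k),
  (forall x, local_max (G k) (cube_dim k) x -> agree (cube_dim k) x (peak k)),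
  exists K us, [/\ 0 <= K, 4 * K + (cube_dim k)%:Z + 1 <= Mk k,
                   clearing_walk (G k) (cube_dim k) K (peak k) us & walk (peak k) us = zero_bits]
  & (cube_dim k)%:Z ^+ 2 + 2 * (cube_dim k)%:Z + 2 < Mk k * ((cube_dim k)%:Z - 1)].

Lemma level_invariant0 : level_invariant 0.
Proof.
have hG x : G 0 x = 2 * bit x 1 + bit x 2 by [].
have coord2 i : is_coord (cube_dim 0) i -> i = 1%N \/ i = 2%N by rewrite /is_coord /cube_dim; lia.
have hM : 12 <= Mk 0 by have := gap_le_Mk 0 (peak 0) zero_bits; rewrite !hG.
split.
- exists [:: 1%N; 2%N]; split=> //; last first.
    by apply: functional_extensionality => d /=; rewrite /peak /cube_dim; eval_bits; lia.
  by split; [|split=> //]; (split=> // i /coord2[]->); rewrite !hG.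
- by move=> i /coord2[]->; rewrite !hG.
- move=> x hl c /coord2 hc; have := hl 1%N isT; have := hl 2%N isT.
  rewrite !hG !bit_toggle_at !bit_toggle_off //.
  by case: hc => ->; rewrite /peak /bit /=; case: (x 1%N); case: (x 2%N).
- exists 2, [:: 2%N; 1%N]; split=> //; first by rewrite /cube_dim; lia.
  + by split; [|split=> //]; (split=> // w i hw /coord2[]->);
      rewrite /loss !hG /bit /toggle /peak /cube_dim //=; lia.
  + by apply: functional_extensionality => d /=; rewrite /peak /cube_dim; eval_bits; lia.
- by rewrite /cube_dim /=; lia.
Qed.

Lemma level_invariantS k : level_invariant k -> level_invariant k.+1.
Proof.
case=> [[js [hjs hrun hsize]] hmax huniq [K [us [hK0 hK hus hrun2]]] hM].
have hM' : 20 + 4 * Mk k + 20 * Mk k * (cube_dim k)%:Z <= Mk k.+1.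
  by apply: Mk_succ_ge; rewrite -hrun; apply: greedy_walk_mono hjs.
have [hK' hM''] := Mk_succ_bounds hM hM'.
have [hjs' hrun'] := greedy_walk_succ hM hjs hrun hmax hK hus hrun2.
have [hus' hrun2'] := clearing_walk_succ hM hK0 hK hus hrun2.
rewrite /level_invariant cube_dimS; split=> //.
- exists (succ_walk k js us); split=> //.
  by rewrite /succ_walk !size_cat /= expnS; lia.
- exact: local_max_peak_succ.
- by move=> x; apply: local_max_succ_agree_peak.
- exists (5 * Mk k * (cube_dim k)%:Z).
  exists (us ++ [:: (cube_dim k).+1; (cube_dim k).+4; (cube_dim k).+3]).
  by split=> //; have := M_ge hM; have := cube_dim_ge2 k; nia.
Qed.

Lemma level_invariant_all k : level_invariant k.
Proof. by elim: k => [|k]; [exact: level_invariant0 | exact: level_invariantS]. Qed.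

Definition bits_of (N : nat) (v : {ffun 'I_N -> bool}) : bits :=
  fun c => if c is c'.+1 then oapp v false (insub c') else false.

Lemma cube_point_bits_of N v : cube_point N (bits_of v) = v.
Proof. by apply/ffunP => i; rewrite ffunE /bits_of valK. Qed.

Lemma agree_cube_point N x y : agree N x y -> cube_point N x = cube_point N y.
Proof. by move=> h; apply/ffunP => i; rewrite !ffunE h // /is_coord; have := ltn_ord i; lia. Qed.

Lemma cube_point_peak k : cube_point (cube_dim k) (peak k) = target (cube_dim k).
Proof. by apply/ffunP => i; rewrite !ffunE /peak; have := ltn_ord i; rewrite /cube_dim; lia. Qed.

Lemma cube_point_zero N : cube_point N zero_bits = [ffun=> false].
Proof. by apply/ffunP => i; rewrite !ffunE. Qed.

Lemma flip_cube_point N (i : 'I_N) x : flip i (cube_point N x) = cube_point N (toggle i.+1 x).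
Proof. by apply/ffunP => j; rewrite !ffunE /toggle. Qed.

Lemma g_cube_point k x : g (cube_point (cube_dim k) x) = G k x.
Proof. by rewrite /g (_ : cube_dim k %/ 4 = k)%N ?gk_cube_point // /cube_dim; lia. Qed.

Lemma is_coord_ord N (i : 'I_N) : is_coord N i.+1.
Proof. by rewrite /is_coord ltn_ord. Qed.

Lemma ord_of_coord N c : is_coord N c -> exists i : 'I_N, c = i.+1.
Proof. by case: c => // c hc; exists (Ordinal hc). Qed.

Lemma local_max_cube k x :
  local_max (G k) (cube_dim k) x <-> is_local_max (@g (cube_dim k)) (cube_point (cube_dim k) x).
Proof.
split=> [hl i | hl c /ord_of_coord[i ->]].
  by rewrite flip_cube_point !g_cube_point; apply/hl/is_coord_ord.
by have := hl i; rewrite flip_cube_point !g_cube_point.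
Qed.

Lemma greedy_move_cube k x j : greedy_move (G k) (cube_dim k) x j ->
  greedy_step_unique (@g _) (cube_point (cube_dim k) x) (cube_point (cube_dim k) (toggle j x)).
Proof.
case=> /ord_of_coord[j' ->] hup hbest; split; first by exists j'; rewrite flip_cube_point.
  by rewrite !g_cube_point.
move=> i; rewrite flip_cube_point !g_cube_point => hne; apply: hbest (is_coord_ord i) _.
by apply: contraNneq hne => ->.
Qed.

Lemma greedy_path_trace k js : greedy_walk (G k) (cube_dim k) zero_bits js ->
  local_max (G k) (cube_dim k) (walk zero_bits js) ->
  greedy_path_no_ties (@g (cube_dim k)) (map (cube_point (cube_dim k)) (trace zero_bits js)).
Proof.
move=> hjs hmax; split; first by rewrite size_map size_trace.
  move=> t; rewrite size_map size_trace ltnS => ht.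
  rewrite -cube_point_zero !(nth_map zero_bits) ?size_trace; try lia.
  have [hmove ->] := greedy_walk_nth zero_bits hjs ht.
  exact: greedy_move_cube.
by rewrite -cube_point_zero last_map last_trace -local_max_cube.
Qed.

Lemma half_cube_dim k : ((cube_dim k)./2 = (2 * k).+1)%N.
Proof.
by rewrite /cube_dim (_ : 4 * k + 2 = ((2 * k).+1).*2)%N ?doubleK //; rewrite -mul2n; lia.
Qed.

Theorem theorem2 (n : nat) (hn : (n %% 4 = 2)%N) :
  exists p : seq {ffun 'I_n -> bool},
    [/\ head [ffun=> false] p = [ffun=> false],
        greedy_path_no_ties (@g n) p,
        last [ffun=> false] p = target n,
        (forall v, is_local_max (@g n) v -> v = target n) &
        (2 ^ (n./2) < (size p).-1 ^ 2)%N ].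
Proof.
have -> : n = cube_dim (n %/ 4) by rewrite /cube_dim {1}(divn_eq n 4) hn; lia.
have [[js [hjs hrun hsize]] hmax huniq _ _] := level_invariant_all (n %/ 4).
set k := (n %/ 4)%N in hjs hrun hsize hmax huniq *.
exists (map (cube_point (cube_dim k)) (trace zero_bits js)); split.
- by case: js {hjs hrun hsize} => [|j js] /=; rewrite cube_point_zero.
- by apply: greedy_path_trace; rewrite ?hrun.
- by rewrite -cube_point_zero last_map last_trace hrun cube_point_peak.
- move=> v; rewrite -(cube_point_bits_of v) -local_max_cube => /huniq/agree_cube_point ->.
  exact: cube_point_peak.
- rewrite size_map size_trace /= half_cube_dim (_ : (2 * k).+1 = k.+1 * 2 - 1)%N; last by lia.
  apply: leq_trans (_ : 2 ^ (k.+1 * 2) <= _)%N; first by rewrite ltn_exp2l //; lia.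
  by rewrite expnM leq_exp2r.
Qed.
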